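(* Every quasiregular coherent configuration with at most three homogeneous components is schurian and separable.
   Context: A coherent configuration is a pair $\mathcal X=(\Omega,S)$ where $\Omega$ is a finite set and $S$ is a partition of $\Omega\times\Omega$ (basis relations) such that the diagonal $1_\Omega$ is a union of basis relations, $s^*=\{(\beta,\alpha):(\alpha,\beta)\in s\}\in S$ for all $s\in S$, and for all $r,s,t\in S$ the number $c^t_{rs}=|\alpha r\cap \beta s^*|$ does not depend on the choice of $(\alpha,\beta)\in t$, where $\alpha r=\{\beta:(\alpha,\beta)\in r\}$. A fiber is a set $\Delta$ with $1_\Delta\in S$; homogeneous components are $(\Delta,\{s\in S:s\subseteq\Delta\times\Delta\})$ for fibers $\Delta$. A relation $s$ is thin if $|\alpha s|\le1$ and $|\alpha s^*|\le 1$ for all $\alpha$. A regular scheme is a coherent configuration with one fiber all of whose basis relations are thin. A coherent configuration is quasiregular if all its homogeneous components are regular schemes. It is schurian if $S$ is the set of orbits on $\Omega\times\Omega$ of some permutation group on $\Omega$. An algebraic isomorphism from $(\Omega,S)$ to a coherent configuration $(\Omega',S')$ is a bijection $\varphi:S\to S'$ with $c^t_{rs}=c^{\varphi(t)}_{\varphi(r)\varphi(s)}$ for all $r,s,t$; the configuration is separable if for every such $\varphi$ there is a bijection $f:\Omega\to\Omega'$ with $\{(\alpha^f,\beta^f):(\alpha,\beta)\in s\}=\varphi(s)$ for all $s\in S$. *)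

(* Defs.v *)
From HB Require Import structures.
From mathcomp Require Import all_boot all_fingroup.

Set Implicit Arguments.
Unset Strict Implicit.
Unset Printing Implicit Defensive.

Section Configurations.
Variable T : finType.

(* The point set [Omega] is a subset of an ambient finite type, so that a
   configuration and its homogeneous components have the same type. *)
Implicit Types (Omega Delta : {set T}) (r s t : {set T * T}).
Implicit Types S : {set {set T * T}}.

Definition diag Delta : {set T * T} := [set (x, x) | x in Delta].

Definition converse s : {set T * T} := [set (p.2, p.1) | p in s].

Definition neighbors (a : T) s : {set T} := [set b | (a, b) \in s].

Definition path_count r s (a b : T) : nat :=
  #|neighbors a r :&: neighbors b (converse s)|.

(* [partition] from finset requires the blocks to be nonempty. *)
Definition coherent_configuration Omega S : Prop :=
  [/\ partition S (setX Omega Omega),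
      exists2 P : {set {set T * T}}, P \subset S & diag Omega = cover P,
      forall s, s \in S -> converse s \in S
    & forall r s t, r \in S -> s \in S -> t \in S ->
      forall a b a' b' : T, (a, b) \in t -> (a', b') \in t ->
      path_count r s a b = path_count r s a' b'].

(* The number c^t_{rs}: in a coherent configuration the value does not depend
   on the pair chosen in [t], and [t] is nonempty. *)
Definition intersection_number r s t : nat :=
  if [pick p in t] is Some p then path_count r s p.1 p.2 else 0.

Definition fibers S : {set {set T}} := [set Delta | diag Delta \in S].

Definition homogeneous_component S Delta : {set T} * {set {set T * T}} :=
  (Delta, [set s in S | s \subset setX Delta Delta]).

Definition homogeneous_components S : {set {set T} * {set {set T * T}}} :=
  [set homogeneous_component S Delta | Delta in fibers S].

Definition thin s : Prop :=
  forall a : T, #|neighbors a s| <= 1 /\ #|neighbors a (converse s)| <= 1.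

Definition regular_scheme Omega S : Prop :=
  [/\ coherent_configuration Omega S,
      #|fibers S| = 1
    & forall s, s \in S -> thin s].

Definition quasiregular S : Prop :=
  forall X, X \in homogeneous_components S -> regular_scheme X.1 X.2.

Definition pair_orbit (G : {set {perm T}}) (p : T * T) : {set T * T} :=
  [set (g p.1, g p.2) | g : {perm T} in G].

Definition schurian S : Prop :=
  exists G : {group {perm T}}, S = [set pair_orbit G p | p : T * T].

End Configurations.

(* Only the restriction of [phi] to [S] matters; it is a bijection S -> S'. *)
Definition algebraic_isomorphism (T T' : finType)
    (S : {set {set T * T}}) (S' : {set {set T' * T'}})
    (phi : {set T * T} -> {set T' * T'}) : Prop :=
  [/\ {in S &, injective phi},
      [set phi s | s in S] = S'
    & forall r s t, r \in S -> s \in S -> t \in S ->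
      intersection_number r s t =
      intersection_number (phi r) (phi s) (phi t)].

Definition separable (T : finType) (S : {set {set T * T}}) : Prop :=
  forall (T' : finType) (S' : {set {set T' * T'}})
         (phi : {set T * T} -> {set T' * T'}),
  coherent_configuration [set: T'] S' ->
  algebraic_isomorphism S S' phi ->
  exists2 f : T -> T', bijective f &
    forall s, s \in S -> [set (f p.1, f p.2) | p in s] = phi s.

(* Main.v *)
(** A homogeneous component all of whose relations are thin is rigid: an
    algebraic isomorphism [phi] determines the image of every point of a fiber
    once the image of one base point of that fiber is known.  Hence a bijection
    inducing [phi] exists as soon as [phi] is respected by one base point per
    fiber.  With at most three fibers there are at most three base points, and a
    pair of points matched by [phi] always extends to a matched triple, because
    [phi] preserves the nonvanishing of the intersection numbers.  So every
    matched pair extends to a bijection inducing [phi]; this gives separability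
    and, for [phi] the identity, schurity. *)
Require Import Defs.
From mathcomp Require Import all_boot all_fingroup.

Set Implicit Arguments.
Unset Strict Implicit.
Unset Printing Implicit Defensive.

(** * Basis relations as colours of pairs; fibers as colours of loops *)

Section Color.
Variables (T : finType) (S : {set {set T * T}}).
Hypothesis coh : coherent_configuration [set: T] S.

Definition color (x y : T) : {set T * T} := pblock S (x, y).

Lemma mem_color x y : (x, y) \in color x y.
Proof.
by case: coh => /and3P[/eqP covS _ _] _ _ _; rewrite mem_pblock covS !inE.
Qed.

Lemma color_mem x y : color x y \in S.
Proof.
by case: coh => /and3P[/eqP covS _ _] _ _ _; apply: pblock_mem; rewrite covS !inE.
Qed.

Lemma colorE s x y : s \in S -> (x, y) \in s -> color x y = s.
Proof. by case: coh => /and3P[_ trivS _] _ _ _; apply: def_pblock. Qed.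

Lemma mem_color_eq x y z w : ((z, w) \in color x y) = (color z w == color x y).
Proof.
apply/idP/eqP => [|<-]; last exact: mem_color.
by apply: colorE; apply: color_mem.
Qed.

Lemma color_surj s : s \in S -> exists x y, color x y = s.
Proof.
move=> Ss; case: (set_0Vmem s) => [s0|[[x y] sxy]].
  by case: coh => /and3P[_ _ /negP[]]; rewrite -s0.
by exists x, y; apply: colorE.
Qed.

Lemma color_diag x y z : color x y = color z z -> x = y.
Proof.
move=> Exy; case: coh => _ [P sPS defP] _ _.
have: (z, z) \in diag [set: T] by apply: imset_f; rewrite inE.
rewrite defP => /bigcupP[s Ps szz].
have Ds := colorE (subsetP sPS s Ps) szz.
have: (x, y) \in cover P.
  by apply/bigcupP; exists s; rewrite // -Ds -Exy mem_color.
by rewrite -defP => /imsetP[w _ [-> ->]].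
Qed.

Lemma mem_converse (s : {set T * T}) x y : ((x, y) \in converse s) = ((y, x) \in s).
Proof.
apply/imsetP/idP => [[[a b] sab [-> ->]] //|syx].
by exists (y, x).
Qed.

Lemma color_converse x y z w : color x y = color z w -> color y x = color w z.
Proof.
move=> Exy; case: coh => _ _ convS _.
have Sc : converse (color z w) \in S by apply/convS/color_mem.
rewrite (colorE (x := w) (y := z) Sc) ?mem_converse ?mem_color //.
by apply: colorE; rewrite // mem_converse -Exy mem_color.
Qed.

Lemma path_count_gt0P (r s : {set T * T}) x y :
  reflect (exists2 z, (x, z) \in r & (z, y) \in s) (0 < path_count r s x y).
Proof.
apply: (iffP card_gt0P) => [[z]|[z rxz szy]].
  by rewrite !inE mem_converse => /andP[rxz szy]; exists z.
by exists z; rewrite !inE mem_converse rxz.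
Qed.

Lemma intersection_numberE r s x y : r \in S -> s \in S ->
  intersection_number r s (color x y) = path_count r s x y.
Proof.
move=> Sr Ss; case: coh => _ _ _ cohS; rewrite /intersection_number.
case: pickP => [[a b] /= tab | /(_ (x, y))]; last by rewrite mem_color.
by apply: (cohS _ _ (color x y)) => //; rewrite ?color_mem ?mem_color.
Qed.

(** At [(z, w)] the point [z] itself witnesses a positive count. Coherence carries the count over to
    [(x, y)], and a witness there forms a pair with [x] of a loop colour, hence is [x]. *)
Lemma color_source x y z w : color x y = color z w -> color x x = color z z.
Proof.
move=> Exy; have: 0 < path_count (color z z) (color z w) z w.
  by apply/path_count_gt0P; exists z; apply: mem_color.
rewrite -intersection_numberE ?color_mem // -Exy intersection_numberE ?color_mem //.
case/path_count_gt0P => v; rewrite mem_color_eq => /eqP Exv _.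
by rewrite -Exv -(color_diag Exv).
Qed.

(** Lets equality of loop colours stand for lying in the same fiber. *)
Lemma color_loopE x : color x x = diag [set y | color y y == color x x].
Proof.
apply/setP=> -[a b]; rewrite mem_color_eq.
apply/eqP/imsetP=> [Eab | [c]]; last by rewrite inE => /eqP Ec [-> ->].
by have Dab := color_diag Eab; subst b; exists a; rewrite // inE Eab.
Qed.

Lemma fiberP x : [set y | color y y == color x x] \in fibers S.
Proof. by rewrite inE -color_loopE color_mem. Qed.

Lemma card_loops :
  #|[set color x x | x : T]| <= #|homogeneous_components S|.
Proof.
apply: leq_trans (leq_imset_card (fun X => diag X.1) _).
apply: subset_leq_card; apply/subsetP=> _ /imsetP[x _ ->].
apply/imsetP; exists (homogeneous_component S [set y | color y y == color x x]).
  exact/imset_f/fiberP.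
exact: color_loopE.
Qed.

(** All pairs of colour [color x y] have both ends in the fiber of [x], so this relation belongs to
    a homogeneous component and is thin. *)
Lemma color_thin x y z : quasiregular S ->
  color x x = color y y -> color x y = color x z -> y = z.
Proof.
move=> qreg Ex Exy; set D := [set w | color w w == color x x].
have [_ _ thinS] := qreg _ (imset_f (homogeneous_component S) (fiberP x)).
have [] := thinS (color x y) _ x.
  rewrite inE color_mem; apply/subsetP=> -[a b]; rewrite mem_color_eq => /eqP Eab.
  rewrite !inE /= (color_source Eab) eqxx.
  by rewrite (color_source (color_converse Eab)) -Ex eqxx.
move=> le1 _; apply: (card_le1_eqP le1); rewrite inE ?mem_color //.
by rewrite Exy mem_color.
Qed.

Lemma cover_loops p q : #|homogeneous_components S| <= 3 -> color p p != color q q ->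
  exists r, forall x,
    [|| color x x == color p p, color x x == color q q | color x x == color r r].
Proof.
move=> le3 neq_pq; have {le3} := leq_trans card_loops le3.
case: (pickP (fun x => (color x x != color p p) && (color x x != color q q))).
  move=> r /andP[neq_rp neq_rq] le3; exists r => x; apply: contraLR le3.
  rewrite !negb_or -ltnNge => /and3P[xp xq xr].
  (* A point outside all three fibers would give a fourth loop colour. *)
  pose s := [:: color x x; color r r; color p p; color q q].
  have uniq_s : uniq s.
    by rewrite /= !inE !negb_or xp xq xr neq_rp neq_rq neq_pq.
  rewrite -[4]/(size s) -(card_uniqP uniq_s); apply: subset_leq_card.
  by apply/subsetP=> t; rewrite !inE => /or4P[]/eqP->; apply: imset_f.
(* The fibers of [p] and [q] exhaust the points, so any [r] will do. *)
move=> cov _; exists p => x; have := cov x.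
by case: eqP => //= _; case: eqP.
Qed.

End Color.

(** * Extending a pair matched by [phi] to a bijection *)

Section Extension.
Variables (T T' : finType) (S : {set {set T * T}}) (S' : {set {set T' * T'}}).
Variable phi : {set T * T} -> {set T' * T'}.
Hypotheses (coh : coherent_configuration [set: T] S) (qreg : quasiregular S).
Hypothesis coh' : coherent_configuration [set: T'] S'.
Hypothesis iso : algebraic_isomorphism S S' phi.

Definition matched (x y : T) (x' y' : T') : Prop :=
  phi (color S x y) = color S' x' y'.

Lemma matched_injl x y x' y' z w : matched x y x' y' -> matched z w x' y' ->
  color S x y = color S z w.
Proof.
by case: iso => injphi _ _ m1 m2; apply: injphi; rewrite ?color_mem // m1 m2.
Qed.

Lemma matched_injr x y x' y' z' w' : matched x y x' y' -> matched x y z' w' ->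
  color S' x' y' = color S' z' w'.
Proof. by move=> <- <-. Qed.

Lemma phi_mem s : s \in S -> phi s \in S'.
Proof. by case: iso => _ <- _ Ss; apply: imset_f. Qed.

Lemma matched_surj x' y' : exists x y, matched x y x' y'.
Proof.
have [_ defS' _] := iso.
have := color_mem coh' x' y'; rewrite -{2}defS' => /imsetP[s Ss Es].
by have [x [y Dxy]] := color_surj coh Ss; exists x, y; rewrite /matched Dxy.
Qed.

Lemma matched_path_count x y x' y' r s : r \in S -> s \in S -> matched x y x' y' ->
  path_count r s x y = path_count (phi r) (phi s) x' y'.
Proof.
move=> Sr Ss m; case: iso => _ _ isoE.
rewrite -(intersection_numberE coh) // isoE ?color_mem // m.
by rewrite (intersection_numberE coh') ?phi_mem.
Qed.

Lemma matched_extend x y x' y' z : matched x y x' y' ->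
  exists2 z', matched x z x' z' & matched z y z' y'.
Proof.
move=> m; have: 0 < path_count (color S x z) (color S z y) x y.
  by apply/path_count_gt0P; exists z; apply: mem_color.
rewrite (matched_path_count _ _ m) ?color_mem //.
case/path_count_gt0P => z' xz zy.
by exists z'; apply/esym; [apply: (colorE coh' _ xz) | apply: (colorE coh' _ zy)];
  apply: phi_mem; apply: color_mem.
Qed.

(** Surjectivity of [phi] writes the two colours at [z'] as images, so positivity of their
    intersection number transfers back to [S]. *)
Lemma matched_extend_inv x y x' y' z' : matched x y x' y' ->
  exists2 z, matched x z x' z' & matched z y z' y'.
Proof.
move=> m.
have [a [b mab]] := matched_surj x' z'.
have [c [d mcd]] := matched_surj z' y'.
have: 0 < path_count (color S' x' z') (color S' z' y') x' y'.
  by apply/path_count_gt0P; exists z'; apply: mem_color.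
rewrite -mab -mcd -(matched_path_count _ _ m) ?color_mem //.
case/path_count_gt0P => z; rewrite !mem_color_eq // => /eqP xz /eqP zy.
by exists z; rewrite /matched ?xz ?zy.
Qed.

(** Pulling [y'] back gives [z] with [color S x z = color S x x], so [z] is [x]; then [(x', y')] and
    [(y', y')] share a colour. *)
Lemma matched_loop x x' y' : matched x x x' y' -> x' = y'.
Proof.
move=> m; have [z m1 m2] := matched_extend_inv y' m.
have Dz := color_diag coh (matched_injl m1 m); subst z.
exact: (color_diag coh' (matched_injr m m2)).
Qed.

Lemma matched_loop_inv x y x' : matched x y x' x' -> x = y.
Proof.
move=> m; have [z' m1 m2] := matched_extend y m.
have Dz := color_diag coh' (matched_injr m1 m); subst z'.
exact: (color_diag coh (matched_injl m m2)).
Qed.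

Lemma matched_source x y x' y' : matched x y x' y' -> matched x x x' x'.
Proof.
move=> m; have [z' m1 _] := matched_extend x m.
by have Dz := matched_loop m1; subst z'.
Qed.

Lemma matched_sym x y x' y' : matched x y x' y' -> matched y x y' x'.
Proof.
move=> m; have [z' m1 m2] := matched_extend y (matched_source m).
by rewrite /matched m2; apply: (color_converse coh'); apply: matched_injr m1 m.
Qed.

(** Thinness is given in [S], so [z'] is pulled back there: its preimage must be [y], and the loop
    at [y] then matches [(z', y')]. *)
Lemma matched_thin x y x' y' z' : color S x x = color S y y ->
  matched x y x' y' -> matched x y x' z' -> y' = z'.
Proof.
move=> Exy m1 m2; have [z m3 m4] := matched_extend_inv z' m1.
have Dz := color_thin coh qreg Exy (matched_injl m2 m3); subst z.
by rewrite (matched_loop m4).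
Qed.

(** Change of base point inside a fiber: extending [(p, q)] by [x] yields a candidate image, which
    rigidity identifies with [x']. *)
Lemma matched_shift p q x p' q' x' : color S p p = color S x x ->
  matched p q p' q' -> matched p x p' x' -> matched x q x' q'.
Proof.
move=> Epx m1 m2; have [z' m3 m4] := matched_extend x m1.
by rewrite (matched_thin Epx m2 m3).
Qed.

(** [b] chooses a base point in each fiber and [b'] prescribes its image; [f x] must sit relative to
    [b' x] as [x] does to [b x]. *)
Lemma extend_from_base (b : T -> T) (b' : T -> T') :
    (forall x, color S (b x) (b x) = color S x x) ->
    (forall x y, color S x x = color S y y -> b x = b y /\ b' x = b' y) ->
    (forall x y, matched (b x) (b y) (b' x) (b' y)) ->
  exists f : T -> T', [/\ bijective f,
    forall x y, matched x y (f x) (f y) & forall x, matched (b x) x (b' x) (f x)].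
Proof.
move=> Eb bE mb.
have ex_f x : exists y', phi (color S (b x) x) == color S' (b' x) y'.
  by have [y' /eqP] := matched_extend x (mb x x); exists y'.
pose f x := xchoose (ex_f x).
have mbf x : matched (b x) x (b' x) (f x) by apply/eqP/(xchooseP (ex_f x)).
(* The ends move one at a time: [b x] to [x], then [b y] to [y]. *)
have mf x y : matched x y (f x) (f y).
  have m1 : matched x (b y) (f x) (b' y).
    exact: matched_shift (Eb x) (mb x y) (mbf x).
  exact/matched_sym/(matched_shift (Eb y) (matched_sym m1) (mbf y)).
have inj_f : injective f.
  by move=> x y Ef; have := mf x y; rewrite Ef; apply: matched_loop_inv.
have surj_f y' : exists x, f x == y'.
  (* The loop at [y'] pulls back to a loop at [z], which reveals the fiber of the preimage; the base
     point of that fiber then locates it. *)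
  have [z [w mzw]] := matched_surj y' y'.
  have Dw := matched_loop_inv mzw; subst w.
  have [x mx mx'] := matched_extend_inv y' (mb z z).
  have Ezx := matched_injl mzw (matched_source mx').
  have [Db Db'] := bE _ _ Ezx.
  exists x; apply/eqP; have := mbf x; rewrite -Db -Db' => mxf.
  by apply: matched_thin mxf mx; rewrite Eb.
exists f; split=> //.
exists (fun y' => xchoose (surj_f y')) => [x | y']; last exact/eqP/(xchooseP (surj_f y')).
by apply: inj_f; apply/eqP/(xchooseP (surj_f (f x))).
Qed.

Lemma extend_pair_cover p q r p' q' :
    (forall x, [|| color S x x == color S p p, color S x x == color S q q
                 | color S x x == color S r r]) ->
    matched p q p' q' ->
  exists f : T -> T', [/\ bijective f, forall x y, matched x y (f x) (f y),
    f p = p' & f q = q'].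
Proof.
move=> cov mpq; have [r' mpr mrq] := matched_extend r mpq.
have [mpp mqq mrr] : [/\ matched p p p' p', matched q q q' q' & matched r r r' r'].
  by split; [apply: matched_source mpq | apply: matched_source (matched_sym mpq)
            | apply: matched_source mrq].
have [mqp mrp mqr] := And3 (matched_sym mpq) (matched_sym mpr) (matched_sym mrq).
(* Some of [p], [q], [r] may share a fiber; the first one in the fiber of [x] is taken. *)
pose sel A (a b c : A) x :=
  if color S x x == color S p p then a else if color S x x == color S q q then b else c.
have [|||f [bij_f mf mbf]] := @extend_from_base (sel _ p q r) (sel _ p' q' r').
- by move=> x; have:= cov x; rewrite /sel; do 2![case: eqP => [-> //|_]] => /eqP.
- by move=> x y; rewrite /sel => ->.
- by move=> x y; rewrite /sel; do 4?case: ifP => _.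
have fp : f p = p' by have := mbf p; rewrite /sel eqxx => /matched_loop.
(* If [q] lies in the fiber of [p], its base point is [p], and thinness still forces [f q = q']. *)
exists f; split=> //; case: (color S q q =P color S p p) => [Eqp | /eqP neq_qp].
  by apply: matched_thin (esym Eqp) _ mpq; rewrite -fp.
by have := mbf q; rewrite /sel (negPf neq_qp) eqxx => /matched_loop.
Qed.

Hypothesis le3 : #|homogeneous_components S| <= 3.

Lemma extend_pair p q p' q' : matched p q p' q' ->
  exists f : T -> T', [/\ bijective f, forall x y, matched x y (f x) (f y),
    f p = p' & f q = q'].
Proof.
move=> mpq; case: (color S p p =P color S q q) => [Epq | /eqP neq_pq]; last first.
  by have [r cov] := cover_loops coh le3 neq_pq; apply: extend_pair_cover cov mpq.
suff [f [bij_f mf fp]] : exists f : T -> T',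
    [/\ bijective f, forall x y, matched x y (f x) (f y) & f p = p'].
  by exists f; split=> //; apply: matched_thin Epq _ mpq; rewrite -fp.
(* [q] shares the fiber of [p], so a point [s] outside it becomes the second base point; if there is
   none, one fiber covers everything. *)
case: (pickP (fun x => color S p p != color S x x)) => [s neq_ps | cov].
  have [r cov] := cover_loops coh le3 neq_ps.
  have [s' mps _] := matched_extend s (matched_source mpq).
  by have [f []] := extend_pair_cover cov mps; exists f.
have [|f []] := @extend_pair_cover p q p p' q' _ mpq; last by exists f.
by move=> x; have /negbFE := cov x; rewrite eq_sym => ->.
Qed.

End Extension.

(** * Schurity and separability *)

Lemma algebraic_isomorphism_id (T : finType) (S : {set {set T * T}}) :
  algebraic_isomorphism S S id.
Proof. by split; [apply: in2W | apply: imset_id | ]. Qed.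

Lemma quasiregular_schurian (T : finType) (S : {set {set T * T}}) :
    coherent_configuration [set: T] S -> quasiregular S ->
    #|homogeneous_components S| <= 3 ->
  schurian S.
Proof.
move=> coh qreg le3.
pose A := [set g : {perm T} | [forall x, forall y, color S (g x) (g y) == color S x y]].
have AP (g : {perm T}) : reflect (forall x y, color S (g x) (g y) = color S x y) (g \in A).
  rewrite inE; apply: (iffP forallP) => Ag x; first by move=> y; apply/eqP/(forallP (Ag x)).
  by apply/forallP=> y; apply/eqP.
have groupA : group_set A.
  apply/group_setP; split=> [|g h /AP Ag /AP Ah]; apply/AP=> x y.
    by rewrite !perm1.
  by rewrite !permM Ah Ag.
have orbitE x y : pair_orbit A (x, y) = color S x y.
  apply/setP=> -[x' y']; rewrite mem_color_eq //.
  apply/imsetP/eqP => [[g /AP Ag [-> ->]] // | E].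
  (* Pairs of equal colour are matched by the identity, so some automorphism carries one to the
     other. *)
  have [f [bij_f mf fx fy]] := extend_pair coh qreg coh
    (algebraic_isomorphism_id S) le3 (esym E).
  exists (perm (bij_inj bij_f)); last by rewrite /= !permE fx fy.
  by apply/AP=> a b; rewrite !permE; symmetry; apply: mf.
exists (Group groupA); apply/setP=> s; apply/idP/imsetP => [Ss | [[x y] _ ->]] /=.
  by have [x [y Exy]] := color_surj coh Ss; exists (x, y); rewrite //= orbitE.
by rewrite orbitE color_mem.
Qed.

Lemma quasiregular_separable (T : finType) (S : {set {set T * T}}) :
    coherent_configuration [set: T] S -> quasiregular S ->
    #|homogeneous_components S| <= 3 ->
  separable S.
Proof.
move=> coh qreg le3 T' S' phi coh' iso.
suff [f bij_f mf] : exists2 f : T -> T', bijective f &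
    forall x y, matched S S' phi x y (f x) (f y).
  exists f => // s Ss; have Sphi := phi_mem iso Ss.
  apply/setP=> -[x' y']; apply/imsetP/idP => [[[x y] sxy [-> ->]] | sxy'].
    by rewrite -(colorE coh Ss sxy) mf mem_color.
  have [g _ fK] := bij_f; exists (g x', g y'); rewrite /= ?fK //.
  have := mf (g x') (g y'); rewrite /matched !fK (colorE coh' Sphi sxy').
  case: iso => inj_phi _ _ /inj_phi <-; rewrite ?color_mem //.
  exact: mem_color.
(* A loop at any point provides a matched pair to extend; if [T] is empty, so is [T'], and the empty
   map serves. *)
case: (pickP (fun _ : T => true)) => [x _ | T0].
  have [x' [y' Exy']] := color_surj coh' (phi_mem iso (color_mem coh x x)).
  have [f []] := extend_pair coh qreg coh' iso le3 (esym Exy').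
  by exists f.
have T'0 (x' : T') : False.
  by have [x _] := matched_surj coh coh' iso x' x'; have := T0 x.
exists (fun x => False_rect T' (notF (esym (T0 x)))); last by move=> x; have := T0 x.
by exists (fun x' => False_rect T (T'0 x')) => x; [have := T0 x | case: (T'0 x)].
Qed.

Theorem theorem1p3 (Omega : finType) (S : {set {set Omega * Omega}})
    (coh : coherent_configuration [set: Omega] S)
    (qreg : quasiregular S)
    (le3 : #|homogeneous_components S| <= 3) :
  schurian S /\ separable S.
Proof. by split; [apply: quasiregular_schurian | apply: quasiregular_separable]. Qed.
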